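(* Let $d,J,n\ge1$ be integers and $r\ge1$. Let $\mathcal{G}_1,\ldots,\mathcal{G}_J$ be nonempty families of invertible maps $\mathbb{R}^d\to\mathbb{R}^d$, let $\mathcal{G}=\mathcal{G}_1\times\cdots\times\mathcal{G}_J$, and for each $j$ set $$L_j=\sup_{x\ne y,\ \varphi_j\in\mathcal{G}_j}\frac{\|\varphi_j(x)-\varphi_j(y)\|}{\|x-y\|}.$$ Assume $L=\max(L_1,\ldots,L_J)<\infty$. Let $\mu_1,\ldots,\mu_J,\mu'_1,\ldots,\mu'_J\in\mathcal{W}_r(\mathbb{R}^d)$. Let $A_{n,r}(\mathcal{G})$ be the empirical minimal alignment cost computed from $J$ independent samples, the $j$th consisting of $n$ iid observations with law $\mu_j$, and let $A'_{n,r}(\mathcal{G})$ be the empirical minimal alignment cost computed from $J$ independent samples, the $j$th consisting of $n$ iid observations with law $\mu'_j$. Then $$W_r^r\Big[\mathcal{L}\big[\{A_{n,r}(\mathcal{G})\}^{1/r}\big],\,\mathcal{L}\big[\{A'_{n,r}(\mathcal{G})\}^{1/r}\big]\Big]\le L^r\,\frac1J\sum_{j=1}^J W_r^r(\mu_j,\mu'_j).$$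
   Context: $\mathcal{W}_r(\mathbb{R}^d)$ is the set of Borel probability measures on $\mathbb{R}^d$ with finite $r$th moment. $W_r(\mu,\nu)$ is the Wasserstein distance, $W_r(\mu,\nu)^r=\inf_{\pi\in\Pi(\mu,\nu)}\int\|x-y\|^r\,d\pi(x,y)$, where $\Pi(\mu,\nu)$ is the set of probability measures on $\mathbb{R}^d\times\mathbb{R}^d$ with marginals $\mu$ and $\nu$; $W_r^r$ means $(W_r)^r$. The Wasserstein $r$-variation is $$V_r(\mu_1,\ldots,\mu_J)=\inf_{\eta\in\mathcal{W}_r(\mathbb{R}^d)}\Big\{\frac1J\sum_{j=1}^J W_r^r(\mu_j,\eta)\Big\}^{1/r}.$$ Given samples $X_{1,j},\ldots,X_{n,j}$, $j\in\{1,\ldots,J\}$, let $\mu_{n,j}(\varphi_j)$ denote the empirical measure on $\varphi_j(X_{1,j}),\ldots,\varphi_j(X_{n,j})$. The empirical minimal alignment cost is $$A_{n,r}(\mathcal{G})=\inf_{(\varphi_1,\ldots,\varphi_J)\in\mathcal{G}}V_r^r\{\mu_{n,1}(\varphi_1),\ldots,\mu_{n,J}(\varphi_J)\}.$$ $\mathcal{L}(Z)$ denotes the law of $Z$; on the left-hand side of the claim $W_r$ is the Wasserstein distance between laws on $\mathbb{R}$. *)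

(* Defs.v *)
From HB Require Import structures.
From mathcomp Require Import all_boot all_order all_algebra.
From mathcomp Require Import all_classical all_reals all_analysis.

Set Implicit Arguments.
Unset Strict Implicit.
Unset Printing Implicit Defensive.

Import Order.TTheory GRing.Theory Num.Theory.
Import numFieldNormedType.Exports.

Local Open Scope classical_set_scope.
Local Open Scope ring_scope.

(* 'rV[R]_d with its Borel sigma-algebra. *)
Definition borelRd (R : realType) (d : nat) :=
  g_sigma_algebraType (@open 'rV[R]_d).

(* The library's norm on 'rV[R]_d is the sup norm. *)
Definition euclid_norm (R : realType) (d : nat) (x : 'rV[R]_d) : R :=
  Num.sqrt (\sum_(i < d) x ord0 i ^+ 2).

Definition euclid_dist (R : realType) (d : nat) (x y : borelRd R d) : R :=
  euclid_norm ((x : 'rV[R]_d) - (y : 'rV[R]_d)).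

Definition real_dist (R : realType) (x y : R) : R := `|x - y|.

Section wasserstein.
Context {R : realType} {dT : measure_display} {T : measurableType dT}.
Variable dist : T -> T -> R.
Implicit Types mu nu : {measure set T -> \bar R}.
Local Open Scope ereal_scope.

Definition couplings mu nu : set (probability (T * T)%type R) :=
  [set pi : probability (T * T)%type R |
    (forall A, measurable A -> pi (A `*` setT) = mu A) /\
    (forall B, measurable B -> pi (setT `*` B) = nu B)].

(* The value is +oo when mu and nu have no coupling. *)
Definition wasserstein (r : R) mu nu : \bar R :=
  (ereal_inf [set \int[(pi : probability (T * T)%type R)]_z
                      ((dist z.1 z.2) `^ r)%:E
             | pi in couplings mu nu]) `^ r^-1.

End wasserstein.

Section independence.
Context {R : realType} {dO dT : measure_display}.
Context {O : measurableType dO} {T : measurableType dT}.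
Local Open Scope ereal_scope.

Definition mutually_independent (P : probability O R) (I : finType)
    (X : I -> {RV P >-> T}) : Prop :=
  forall (K : {set I}) (B : I -> set T), (forall i, measurable (B i)) ->
    P (\bigcap_(i in [set` K]) (X i @^-1` B i)) =
    \prod_(i in K) P (X i @^-1` B i).

(* X i j is the i-th observation of the j-th sample. *)
Definition iid_samples (P : probability O R) (n J : nat)
    (mu : 'I_J -> probability T R) (X : 'I_n -> 'I_J -> {RV P >-> T}) : Prop :=
  mutually_independent (fun ij : 'I_n * 'I_J => X ij.1 ij.2) /\
  forall i j B, measurable B -> distribution P (X i j) B = mu j B.

End independence.

Section empirical.
Context {R : realType} {dT : measure_display} {T : measurableType dT}.
Variables (n : nat) (x : 'I_n -> T).
Local Open Scope ereal_scope.

Definition empirical (A : set T) : \bar R :=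
  (n%:R^-1)%:E * \sum_(i < n) \d_(x i) A.

Let empirical0 : empirical set0 = 0.
Proof. by rewrite /empirical big1 ?mule0// => i _; rewrite measure0. Qed.

Let empirical_ge0 A : 0 <= empirical A.
Proof. by rewrite mule_ge0 ?lee_fin ?invr_ge0// sume_ge0. Qed.

Let empirical_sigma_additive : semi_sigma_additive empirical.
Proof.
move=> F mF tF mUF; rewrite /empirical.
rewrite [X in X @ _ --> _](_ : _ = (fun k => (n%:R^-1)%:E *
    \sum_(i < n) \sum_(0 <= l < k) \d_(x i) (F l))); last first.
  apply/funext => k; rewrite exchange_big/= ge0_sume_distrr// => l _.
  by rewrite sume_ge0.
apply: cvgeZl => //; apply: cvg_nnesum => [i _|i _].
  by apply: nearW => k; exact: sume_ge0.
exact: measure_semi_sigma_additive.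
Qed.

HB.instance Definition _ := isMeasure.Build _ _ _ empirical
  empirical0 empirical_ge0 empirical_sigma_additive.

End empirical.

Section alignment.
Context {R : realType} {d : nat}.
Local Notation Rd := (borelRd R d).
Local Open Scope ereal_scope.

Definition finite_moment (r : R) (mu : probability Rd R) : Prop :=
  \int[mu]_x ((euclid_norm (x : 'rV[R]_d)) `^ r)%:E < +oo.

Definition wasserstein_variation (r : R) (J : nat)
    (mu : 'I_J -> {measure set Rd -> \bar R}) : \bar R :=
  ereal_inf [set ((J%:R^-1)%:E *
      \sum_(j < J) wasserstein (@euclid_dist R d) r (mu j)
                     (eta : probability Rd R) `^ r) `^ r^-1
    | eta in finite_moment r].

(* x i j is the i-th observation of the j-th sample, and the infimum runs over
   the product of the families G j. *)
Definition min_alignment_cost (r : R) (n J : nat)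
    (G : 'I_J -> set (Rd -> Rd)) (x : 'I_n -> 'I_J -> Rd) : \bar R :=
  ereal_inf [set wasserstein_variation r
      (fun j => empirical (fun i => phi j (x i j))) `^ r
    | phi in [set phi : 'I_J -> Rd -> Rd | forall j, G j (phi j)]].

Definition lipschitz_sup (F : set (Rd -> Rd)) : \bar R :=
  ereal_sup [set l | exists (phi : Rd -> Rd) (x y : Rd),
    [/\ F phi, x <> y & l = (euclid_dist (phi x) (phi y) / euclid_dist x y)%:E]].

End alignment.

(* Main.v *)
From HB Require Import structures.
Require Import Defs.
From mathcomp Require Import all_boot all_order all_algebra.
From mathcomp Require Import all_classical all_reals all_analysis.
From mathcomp Require Import measurable_realfun lra.

(* Write A for the minimal alignment cost, seen as a function of the sample
   points.  Its r-th root is Lipschitz: a coupling of an empirical measure with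
   eta can be transported to a coupling of a moved empirical measure with eta,
   at a cost controlled by the displacements, and this bound passes through the
   infima over couplings, eta and G.  Now take couplings of mu_j and mu'_j and
   draw all pairs of observations independently from them: the two values of
   A^(1/r) form a coupling of the two laws, and integrating the Lipschitz bound
   gives the claim once the couplings become optimal. *)

Set Implicit Arguments.
Unset Strict Implicit.
Unset Printing Implicit Defensive.

Import Order.TTheory GRing.Theory Num.Theory.
Import numFieldNormedType.Exports.

Local Open Scope classical_set_scope.
Local Open Scope ring_scope.
Local Open Scope ereal_scope.

(** * Infima of extended reals and Minkowski's inequality *)

(** The r-th root bound is a triangle inequality for nested infima of averages of integrals. What is
    carried through the levels is a linear estimate, with constants c1, c2 such that (a + b)^r <= c1
    a^r + c2 b^r for all a, b >= 0: it commutes with sums, integrals and infima, and roots are taken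
    only once, at the end. Because the moved measure is finitely supported, gluing amounts to
    restricting the coupling to the strip above each atom. The cost is an infimum over possibly
    uncountable families, so its measurability is a genuine question; the Lipschitz bound answers it
    by reducing to countably many rational samples. *)

Section ereal_inf_complements.
Context {R : realType}.
Implicit Types (S : set (\bar R)) (a : \bar R) (b c p : R).

(** For c > 0 the map s -> c s + b is an increasing bijection of the extended reals, so the bound
    passes to the infimum even when that is infinite. *)
Lemma lee_ereal_inf_affine S a c b : (0 < c)%R ->
  (forall s, S s -> a <= c%:E * s + b%:E) -> a <= c%:E * ereal_inf S + b%:E.
Proof.
move=> c0 aS; rewrite -leeBlDr// -lee_pdivrMl//; apply/ereal_infP => s Ss.
by rewrite lee_pdivrMl// leeBlDr// aS.
Qed.

Lemma lee_poweR p (x y : \bar R) : (0 <= p)%R -> 0 <= x -> x <= y ->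
  x `^ p <= y `^ p.
Proof.
move=> p0 x0 xy; apply: gt0_ler_poweR => //; rewrite in_itv/= leey andbT //.
exact: le_trans xy.
Qed.

Lemma poweRK p (x : \bar R) : p != 0%R -> 0 <= x -> (x `^ p) `^ p^-1 = x.
Proof. by move=> p0 x0; rewrite -poweRrM divff// poweRe1. Qed.

Lemma poweRVK p (x : \bar R) : p != 0%R -> 0 <= x -> (x `^ p^-1) `^ p = x.
Proof. by move=> p0 x0; rewrite -poweRrM mulVf// poweRe1. Qed.

(** Raising to the power p is an order isomorphism of [0, +oo], with inverse the power 1/p, so it
    preserves infima. *)
Lemma poweR_ereal_inf S p : (0 < p)%R -> (forall s, S s -> 0 <= s) ->
  (ereal_inf S) `^ p = ereal_inf [set s `^ p | s in S].
Proof.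
move=> p0 S0; apply/eqP; rewrite eq_le; apply/andP; split.
  apply/ereal_infP => _ [s Ss <-]; apply: lee_poweR (ltW p0) _ _.
    by apply/ereal_infP => x /S0.
  exact: ereal_inf_lbound.
set m := ereal_inf _.
have m0 : 0 <= m by apply/ereal_infP => _ [s Ss <-]; exact: poweR_ge0.
rewrite -(@poweRVK p m) ?gt_eqF//; apply: lee_poweR (ltW p0) _ _.
  exact: poweR_ge0.
apply/ereal_infP => s Ss; rewrite -(@poweRK p s) ?gt_eqF ?S0//.
apply: lee_poweR => //; first by rewrite invr_ge0 ltW.
by apply: ereal_inf_lbound; exists s.
Qed.

End ereal_inf_complements.

Section minkowski_principle.
Context {R : realType}.
Local Open Scope ring_scope.

(** Convexity of the r-th power, applied to a + b = t (a / t) + (1 - t) (b / (1 - t)). *)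
Lemma powR_add_le (r t a b : R) : 1 <= r -> 0 < t -> t < 1 -> 0 <= a -> 0 <= b ->
  (a + b) `^ r <= t * t^-1 `^ r * a `^ r + (1 - t) * (1 - t)^-1 `^ r * b `^ r.
Proof.
move=> r1 t0 t1 a0 b0.
have u0 : 0 < 1 - t by rewrite subr_gt0.
pose w := Itv01 (ltW t0) (ltW t1).
have := @convex_powR R r r1 w (a / t) (b / (1 - t)).
rewrite !inE/= !in_itv/= !andbT !divr_ge0 ?(ltW t0) ?(ltW u0)//.
move=> /(_ isT isT).
rewrite [X in _ <= X -> _]convRE [X in X `^ r <= _ -> _]convRE /unstable.onem/=.
rewrite !powRM ?invr_ge0 ?(ltW t0) ?(ltW u0)//.
rewrite ![_ * (_ / _)]mulrC !divfK ?gt_eqF// => /le_trans; apply.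
by rewrite -!mulrA (mulrC (a `^ r)) (mulrC (b `^ r)).
Qed.

(* Optimizing the weights in the convexity inequality recovers the triangle
   inequality: it is enough to push the linear estimate with fixed weights
   through the sums, integrals and infima defining A, al and be. *)
Lemma minkowski_principle (r A al be : R) : 1 <= r ->
    0 <= A -> 0 <= al -> 0 <= be ->
    (forall c1 c2 : R, 0 < c1 -> 0 <= c2 ->
      (forall a b : R, 0 <= a -> 0 <= b ->
        (a + b) `^ r <= c1 * a `^ r + c2 * b `^ r) ->
      A `^ r <= c1 * al `^ r + c2 * be `^ r) ->
  A <= al + be.
Proof.
move=> r1 A0 al0 be0 H; apply/ler_addgt0Pr => e e0.
have r0 : 0 < r by exact: lt_le_trans r1.
have e20 : 0 < e / 2 by rewrite divr_gt0.
(* The slack makes both terms positive, so that the weight [t] below lies strictly between 0 and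
   1. *)
set a := al + e / 2; set b := be + e / 2.
have a0 : 0 < a by rewrite ltr_wpDl.
have b0 : 0 < b by rewrite ltr_wpDl.
have ab0 : 0 < a + b by rewrite addr_gt0.
have -> : al + be + e = a + b.
  by rewrite /a /b addrACA -splitr.
rewrite leNgt; apply/negP => abA.
have := @gt0_ltr_powR R r r0 (a + b) A.
rewrite !nnegrE => /(_ (ltW ab0) A0 abA).
apply/negP; rewrite -leNgt.
(* With this weight a / t and b / (1 - t) both equal a + b, so the convexity bound becomes an
   equality and returns (a + b)^r. *)
pose t := a / (a + b).
have t0 : 0 < t by rewrite divr_gt0.
have tE : 1 - t = b / (a + b).
  by rewrite /t -{1}(@divff _ (a + b)) ?gt_eqF// -mulrBl addrAC subrr add0r.
have u0 : 0 < 1 - t by rewrite tE divr_gt0.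
have t1 : t < 1 by rewrite -subr_gt0.
apply: le_trans (H (t * t^-1 `^ r) ((1 - t) * (1 - t)^-1 `^ r) _ _ _) _.
- by rewrite mulr_gt0// powR_gt0// invr_gt0.
- by rewrite mulr_ge0 ?powR_ge0// ltW.
- by move=> *; exact: powR_add_le.
apply: (@le_trans _ _ (t * t^-1 `^ r * a `^ r + (1 - t) * (1 - t)^-1 `^ r * b `^ r)).
  by apply: lerD; (apply: ler_wpM2l;
    [by rewrite mulr_ge0 ?powR_ge0 ?(ltW t0) ?(ltW u0)
    |by apply: ge0_ler_powR;
       rewrite ?nnegrE ?(ltW r0) ?(ltW a0) ?(ltW b0)// lerDl ltW]).
rewrite -!mulrA -!powRM ?invr_ge0 ?(ltW t0) ?(ltW u0) ?(ltW a0) ?(ltW b0)//.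
have -> : t^-1 * a = a + b by rewrite /t invf_div divfK// gt_eqF.
have -> : (1 - t)^-1 * b = a + b by rewrite tE invf_div divfK// gt_eqF.
by rewrite mulrA -/t -mulrDl addrC subrK mul1r.
Qed.

End minkowski_principle.

(** * The Euclidean distance *)

Section euclid.
Context {R : realType} {d : nat}.
Local Notation Rd := (borelRd R d).
Local Open Scope ring_scope.
Implicit Types x y z : Rd.

Lemma euclid_norm_ge0 (x : 'rV[R]_d) : 0 <= euclid_norm x.
Proof. exact: sqrtr_ge0. Qed.

Lemma sum_sqr_ge0 (x : 'rV[R]_d) : 0 <= \sum_(i < d) x ord0 i ^+ 2.
Proof. by apply: sumr_ge0 => i _; exact: sqr_ge0. Qed.

Lemma euclid_norm_sqr (x : 'rV[R]_d) :
  euclid_norm x ^+ 2 = \sum_(i < d) x ord0 i ^+ 2.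
Proof. by rewrite sqr_sqrtr// sum_sqr_ge0. Qed.

Lemma euclid_normN (x : 'rV[R]_d) : euclid_norm (- x) = euclid_norm x.
Proof.
by rewrite /euclid_norm; congr Num.sqrt; apply: eq_bigr => i _; rewrite mxE sqrrN.
Qed.

(** The case r = 2 of the principle: the linear estimate holds for each coordinate and is summed. *)
Lemma ler_euclid_normD (x y : 'rV[R]_d) :
  euclid_norm (x + y) <= euclid_norm x + euclid_norm y.
Proof.
apply: (@minkowski_principle _ 2) => //; rewrite ?euclid_norm_ge0 ?ler1n//.
move=> c1 c2 c10 c20 c12.
rewrite !powR_mulrn ?euclid_norm_ge0// !euclid_norm_sqr !mulr_sumr -big_split/=.
apply: ler_sum => i _; rewrite mxE.
have := c12 `|x ord0 i| `|y ord0 i| (normr_ge0 _) (normr_ge0 _).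
rewrite !powR_mulrn ?addr_ge0// !real_normK ?num_real//; apply: le_trans.
by rewrite -[leLHS]real_normK ?num_real// lerXn2r ?nnegrE ?addr_ge0 ?ler_normD.
Qed.

Lemma euclid_dist_ge0 x y : 0 <= euclid_dist x y.
Proof. exact: euclid_norm_ge0. Qed.

Lemma euclid_distC x y : euclid_dist x y = euclid_dist y x.
Proof. by rewrite /euclid_dist -euclid_normN opprB. Qed.

Lemma euclid_dist_triangle y x z :
  euclid_dist x z <= euclid_dist x y + euclid_dist y z.
Proof.
by rewrite /euclid_dist -[X in euclid_norm X](subrKA (y : 'rV_d)) ler_euclid_normD.
Qed.

Lemma euclid_dist_xx x : euclid_dist x x = 0.
Proof.
rewrite /euclid_dist subrr /euclid_norm big1 ?sqrtr0// => i _.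
by rewrite mxE expr0n.
Qed.

Lemma euclid_dist_eq0 x y : euclid_dist x y = 0 -> x = y.
Proof.
move=> /(congr1 (fun u => u ^+ 2)); rewrite euclid_norm_sqr expr0n/= => /eqP.
rewrite psumr_eq0; last by move=> *; exact: sqr_ge0.
move=> /allP xy; apply/rowP => i; apply/eqP; rewrite -subr_eq0.
by have := xy i (mem_index_enum i); rewrite /= !mxE sqrf_eq0.
Qed.

(** The constant d is cruder than its square root, which is harmless for approximation by rational
    points; it comes from d <= d^2. *)
Lemma euclid_norm_le (e : R) (x : 'rV[R]_d) : 0 <= e ->
  (forall i, `|x ord0 i| <= e) -> euclid_norm x <= d%:R * e.
Proof.
move=> e0 xe; rewrite -(ler_pXn2r (ltn0Sn 1)) ?nnegrE ?euclid_norm_ge0 ?mulr_ge0//.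
rewrite euclid_norm_sqr exprMn.
apply: (@le_trans _ _ (\sum_(i < d) e ^+ 2)).
  by apply: ler_sum => i _; rewrite -real_normK ?num_real// lerXn2r ?nnegrE.
rewrite sumr_const card_ord -[leLHS]mulr_natl ler_wpM2r ?sqr_ge0// -natrX ler_nat.
by case: d => // k; rewrite -{1}(expn1 k.+1) leq_pexp2l.
Qed.

Lemma measurable_coord (i : 'I_d) :
  measurable_fun [set: Rd] (fun x : Rd => (x : 'rV[R]_d) ord0 i).
Proof.
apply: (measurability (@RGenOInfty.G R)); first exact: RGenOInfty.measurableE.
move=> _ [_ [a ->] <-]; rewrite setTI; apply: sub_sigma_algebra.
by apply: open_comp => [? _|]; [exact: coord_continuous|exact: interval_open].
Qed.

(** Expanding in coordinates gives joint measurability for the product sigma-algebra on pairs,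
    without comparing it with the Borel sets of the product space. *)
Lemma measurable_euclid_dist dO (O : measurableType dO) (f g : O -> Rd) :
  measurable_fun [set: O] f -> measurable_fun [set: O] g ->
  measurable_fun [set: O] (fun w => euclid_dist (f w) (g w)).
Proof.
move=> mf mg.
rewrite (_ : (fun w => _) = (@powR R ^~ 2^-1) \o
    (fun w => \sum_(i < d) ((f w : 'rV_d) ord0 i - (g w : 'rV_d) ord0 i) ^+ 2)).
  apply: measurableT_comp; first exact: measurable_powR.
  apply: measurable_sum => i; apply: measurable_funX; apply: measurable_funB.
    exact: (measurableT_comp (measurable_coord i)).
  exact: (measurableT_comp (measurable_coord i)).
apply/funext => w /=; rewrite powR12_sqrt.
  by congr Num.sqrt; apply: eq_bigr => i _; rewrite !mxE.
by apply: sumr_ge0 => i _; exact: sqr_ge0.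
Qed.

Lemma measurable_euclid_dist_powR (r : R) dO (O : measurableType dO)
    (f g : O -> Rd) :
  measurable_fun [set: O] f -> measurable_fun [set: O] g ->
  measurable_fun [set: O] (fun w => (euclid_dist (f w) (g w) `^ r)%:E).
Proof.
move=> mf mg; apply/measurable_EFinP.
by apply: (measurableT_comp (@measurable_powR R r)); exact: measurable_euclid_dist.
Qed.

Lemma borelRd_measurable_set1 x : measurable [set x].
Proof.
rewrite (_ : [set x] = [set y | euclid_dist y x <= 0]).
  rewrite -[X in measurable X]setTI.
  apply: (@measurable_fun_ler _ _ _ _ (fun y => euclid_dist y x) (cst 0)) => //.
  by apply: measurable_euclid_dist.
apply/seteqP; split => [_ ->|y /=]/=; first by rewrite euclid_dist_xx.
move=> yx; apply: euclid_dist_eq0; apply/eqP; rewrite eq_le yx.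
exact: euclid_dist_ge0.
Qed.

End euclid.

(** * Moving the atoms of an empirical measure in a coupling *)

Section measure_constructions.
Context {R : realType}.

Lemma integral_mrestr d (T : measurableType d) (mu : {measure set T -> \bar R})
    (D : set T) (mD : measurable D) (f : T -> \bar R) :
  measurable_fun setT f -> (forall x, 0 <= f x) ->
  \int[mrestr mu mD]_x f x = \int[mu]_(x in D) f x.
Proof.
move=> mf f0.
have mD' := measurableC mD.
have D0 : mrestr mu mD (~` D) = 0 by rewrite /mrestr setICl measure0.
rewrite [LHS](@ge0_negligible_integral _ _ _ _ _ (~` D))//.
rewrite setTD setCK; apply: eq_measure_integral => A mA AD.
by rewrite /= /mrestr setIidl.
Qed.

Lemma pushforward_mrestr d d' (T : measurableType d) (T' : measurableType d')
    (mu : {measure set T -> \bar R}) (D : set T) (g : T -> T') :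
  measurable D -> measurable_fun setT g ->
  exists nu : {measure set T' -> \bar R},
    (forall C, nu C = mu (g @^-1` C `&` D)) /\
    forall f : T' -> \bar R, measurable_fun setT f -> (forall x, 0 <= f x) ->
      \int[nu]_x f x = \int[mu]_(x in D) f (g x).
Proof.
move=> mD mg.
pose nu : {measure set T' -> \bar R} :=
  ltac:(refine (pushforward (mrestr mu mD) g : {measure set T' -> \bar R});
    exact: mg).
exists nu; split => // f mf f0.
rewrite ge0_integral_pushforward// preimage_setT integral_mrestr//.
  exact: measurableT_comp.
by move=> x; exact: f0.
Qed.

Lemma mixture_probability d (T : measurableType d) (n : nat) (w : 'I_n -> R)
    (nu : 'I_n -> {measure set T -> \bar R}) :
  (forall i, 0 <= w i)%R -> \sum_(i < n) (w i)%:E * nu i setT = 1 ->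
  exists Q : probability T R,
    (forall A, measurable A -> Q A = \sum_(i < n) (w i)%:E * nu i A) /\
    forall f : T -> \bar R, measurable_fun setT f -> (forall x, 0 <= f x) ->
      \int[Q]_x f x = \sum_(i < n) (w i)%:E * \int[nu i]_x f x.
Proof.
(* Total mass 1 rules out an empty mixture; a successor then lets [inord] index the measures by
   natural numbers, as [msum] requires. *)
case: n w nu => [|n] w nu w0 nu1.
  by move: nu1; rewrite big_ord0 => /eqP; rewrite eq_sym onee_eq0.
pose m k : {measure set T -> \bar R} :=
  mscale (NngNum (w0 (inord k))) (nu (inord k)).
pose M : {measure set T -> \bar R} := msum m n.+1.
have ME A : M A = \sum_(i < n.+1) (w i)%:E * nu i A.
  by apply: eq_bigr => i _; rewrite /m inord_val.
(* M has total mass 1, so mnormalize leaves it unchanged and only packages it as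
   a probability; the default P0 is never used. *)
pose P0 : probability T R := \d_(point : T).
have QE A : mnormalize M P0 A = M A.
  by rewrite /mnormalize (ME setT) nu1 onee_eq0/= invr1 mule1.
exists (mnormalize M P0); split => [A _|f mf f0]; first by rewrite -ME; exact: QE.
rewrite (@eq_measure_integral _ _ _ _ M)/=; last by move=> A _ _; exact: QE.
rewrite ge0_integral_measure_sum//; apply: eq_bigr => i _.
by rewrite /m inord_val ge0_integral_mscale.
Qed.

End measure_constructions.

Section gluing.
Context {R : realType} {dT : measure_display} {T : measurableType dT}.
Hypothesis mset1 : forall x : T, measurable [set x].

Lemma measurable_fst_eq (a : T) : measurable [set z : T * T | z.1 = a].
Proof.
by have := @measurable_fst _ _ T T measurableT _ (mset1 a); rewrite setTI.
Qed.

Lemma empirical_set1 n (x : 'I_n -> T) (a : T) :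
  empirical x [set a] = (n%:R^-1 * #|[pred i | x i == a]|%:R)%:E :> \bar R.
Proof.
rewrite /empirical EFinM; congr (_ * _).
rewrite -sum1_card natr_sum -sumEFin [RHS]big_mkcond/=; apply: eq_bigr => i _.
rewrite diracE inE; case: ifPn => [/eqP ->|xa]; first by rewrite mem_set.
by rewrite memNset// => /eqP; exact/negP.
Qed.

(* The i-th atom y' i carries mass m_i / n, where m_i is its multiplicity; each
   of the m_i indices sharing it receives the fraction 1 / m_i of the part of pi
   above it, moved to y i. *)
Lemma coupling_move_empirical n (y y' : 'I_n -> T)
    (eta : {measure set T -> \bar R}) (pi : probability (T * T)%type R) :
  (0 < n)%N -> couplings (empirical y') eta pi ->
  exists m : 'I_n -> nat,
  exists2 rho : probability (T * T)%type R, couplings (empirical y) eta rho &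
  [/\ forall i, (m i)%:R^-1%:E * pi [set z | z.1 = y' i] = (n%:R^-1)%:E,
   (forall f : T * T -> \bar R, measurable_fun setT f -> (forall z, 0 <= f z) ->
      \sum_(i < n) (m i)%:R^-1%:E * \int[pi]_(z in [set z | z.1 = y' i]) f z =
      \int[pi]_z f z) &
   forall f : T * T -> \bar R, measurable_fun setT f -> (forall z, 0 <= f z) ->
     \int[rho]_z f z =
     \sum_(i < n) (m i)%:R^-1%:E *
       \int[pi]_(z in [set z | z.1 = y' i]) f (y i, z.2)].
Proof.
move=> n0 [pi1 pi2].
pose m i := #|[pred k | y' k == y' i]|.
have m0 i : (0 < m i)%N by apply/card_gt0P; exists i; rewrite inE.
pose D i := [set z : T * T | z.1 = y' i].
have mD i : measurable (D i) by exact: measurable_fst_eq.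
have n1 i : (m i)%:R^-1%:E * pi (D i) = (n%:R^-1)%:E.
  have -> : D i = [set y' i] `*` setT.
    by apply/seteqP; split => [z/= ->|z/= []].
  rewrite (pi1 _ (mset1 _)) [X in _ * X](empirical_set1 y' (y' i)) -EFinM.
  rewrite mulrCA mulVf ?mulr1// pnatr_eq0 -lt0n.
  exact: m0.
(* Exactly m_i indices share a given atom, so their fractions 1 / m_i sum to 1. *)
have cover (z : T * T) : (exists k, z.1 = y' k) ->
    (\sum_(i < n | y' i == z.1) (m i)%:R^-1 = 1 :> R)%R.
  move=> [k zk]; rewrite (eq_bigr (fun=> (m k)%:R^-1))%R; last first.
    by move=> i /eqP yi; rewrite /m yi zk.
  rewrite sumr_const -[LHS]mulr_natr.
  rewrite (_ : #|_| = m k); first by rewrite mulVf// pnatr_eq0 -lt0n.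
  by rewrite /m zk; apply: eq_card => i; rewrite !inE.
(* The first marginal of [pi] is carried by the atoms, so [pi] is null off the union of the strips
   [D i]. *)
pose S := \bigcup_k [set y' k].
have mS : measurable S by apply: fin_bigcup_measurable => //; exact: finite_finset.
pose N := ~` S `*` [set: T].
have mN : measurable N by apply: measurableX => //; exact: measurableC.
have piN : pi N = 0.
  rewrite (pi1 _ (measurableC mS)) /= /empirical big1 ?mule0// => k _.
  by rewrite diracE memNset//; apply; exists k.
(* By [cover], the indicators of the [D i] weighted by 1 / m_i form a partition of unity outside
   [N]. *)
have split_int (f : T * T -> \bar R) : measurable_fun setT f ->
    (forall z, 0 <= f z) ->
    \sum_(i < n) (m i)%:R^-1%:E * \int[pi]_(z in D i) f z = \int[pi]_z f z.
  move=> mf f0.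
  have mfD i : measurable_fun setT (f \_ (D i)).
    exact: ((measurable_restrictT f (mD i)).1 (measurable_funTS mf)).
  have fD0 i z : 0 <= (f \_ (D i)) z by exact: erestrict_ge0.
  have mE i : measurable_fun setT (fun z => (m i)%:R^-1%:E * (f \_ (D i)) z).
    exact: measurable_funeM.
  have E0 i z : 0 <= (m i)%:R^-1%:E * (f \_ (D i)) z.
    by rewrite mule_ge0// lee_fin invr_ge0.
  under eq_bigr do rewrite integral_mkcond -ge0_integralZl_EFin ?invr_ge0//.
  rewrite -ge0_integral_sum//.
  rewrite [LHS](ge0_negligible_integral mN)//; last 2 first.
  - exact: emeasurable_sum.
  - by move=> z _; exact: sume_ge0.
  rewrite [RHS](ge0_negligible_integral mN)//.
  apply: eq_integral => z; rewrite inE => -[_ /= Nz].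
  have /cover zS : exists k, z.1 = y' k.
    apply: contrapT => zk; apply: Nz; split => // -[k _ /= zk']; apply: zk.
    by exists k.
  transitivity ((\sum_(i < n | y' i == z.1) (m i)%:R^-1)%R%:E * f z); last first.
    by rewrite zS mul1e.
  rewrite -sumEFin ge0_sume_distrl; last first.
    by move=> i _; rewrite lee_fin invr_ge0.
  rewrite [RHS]big_mkcond/=; apply: eq_bigr => i _.
  rewrite patchE; case: ifPn => [/set_mem|].
    by rewrite /D/= => ->; rewrite eqxx.
  rewrite notin_setE /D/= => /eqP; rewrite eq_sym => /negbTE ->.
  exact: mule0.
pose g i (z : T * T) := (y i, z.2).
have mg i : measurable_fun setT (g i) by apply: measurable_fun_pair.
have /choice[nu nuP] i := pushforward_mrestr pi (mD i) (mg i).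
have w0 i : (0 <= (m i)%:R^-1 :> R)%R by rewrite invr_ge0.
have [|rho [rhoE rhoI]] := mixture_probability w0 (nu := nu).
  rewrite (eq_bigr (fun=> (n%:R^-1)%:E)).
    rewrite sumEFin sumr_const card_ord -[X in X%:E]mulr_natr mulVf//.
    by rewrite pnatr_eq0 -lt0n.
  by move=> i _; rewrite (nuP i).1 preimage_setT setTI n1.
exists m, rho; last first.
  split=> // f mf f0; rewrite rhoI//; apply: eq_bigr => i _.
  by rewrite (nuP i).2.
(* First marginal: the i-th piece has mass 1 / n and sits entirely above [y i]. *)
split=> [A mA|B mB].
  rewrite rhoE; last exact: measurableX.
  transitivity ((n%:R^-1)%:E * \sum_(i < n) (\d_(y i) A : \bar R)) => //.
  rewrite ge0_sume_distrr//; apply: eq_bigr => i _.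
  rewrite (nuP i).1 diracE; have [yA|yA] := boolP (y i \in A).
    rewrite mule1 -(n1 i); congr (_ * pi _); apply/seteqP; split => [z []//|z Dz].
    by split => //; split => //; exact: set_mem.
  rewrite mule0 (_ : _ `&` _ = set0) ?measure0 ?mule0//.
  by apply/seteqP; split => // z [[/= /mem_set]]; rewrite (negbTE yA).
(* Second marginal: [g i] keeps the second coordinate, so the pieces recombine to [pi] by
   [split_int]. *)
rewrite rhoE; last exact: measurableX.
have mB' : measurable ([set: T] `*` B) by exact: measurableX.
rewrite -pi2//.
transitivity (\int[pi]_z (\1_([set: T] `*` B) z)%:E); last first.
  by rewrite integral_indic// setIT.
rewrite -split_int//.
- by apply: eq_bigr => i _; rewrite integral_indic// (nuP i).1.
- by apply/measurable_EFinP; exact: measurable_indic.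
Qed.
End gluing.

(** * Lipschitz bound for the minimal alignment cost *)

Section wasserstein_complements.
Context {R : realType} {dT : measure_display} {T : measurableType dT}.
Variable dist : T -> T -> R.
Implicit Types mu nu : {measure set T -> \bar R}.

Lemma wasserstein_powR r mu nu : (0 < r)%R ->
  wasserstein dist r mu nu `^ r =
  ereal_inf [set \int[(pi : probability (T * T)%type R)]_z
                      ((dist z.1 z.2) `^ r)%:E | pi in couplings mu nu].
Proof.
move=> r0; rewrite poweRVK ?gt_eqF//; apply/ereal_infP => _ [pi _ <-].
by apply: integral_ge0 => z _; rewrite lee_fin powR_ge0.
Qed.

Lemma wasserstein_powR_le r mu nu (pi : probability (T * T)%type R) :
  (0 < r)%R -> couplings mu nu pi ->
  wasserstein dist r mu nu `^ r <= \int[pi]_z ((dist z.1 z.2) `^ r)%:E.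
Proof.
by move=> r0 cpi; rewrite wasserstein_powR//; apply: ereal_inf_lbound; exists pi.
Qed.

Hypothesis mset1 : forall x : T, measurable [set x].
Hypothesis mdist : measurable_fun setT (fun z : T * T => dist z.1 z.2).
Hypothesis dist_ge0 : forall x y, (0 <= dist x y)%R.
Hypothesis dist_triangle : forall y x z, (dist x z <= dist x y + dist y z)%R.

(** On the strip above [y' i] the moved coupling pays at most dist (y i) (y' i) plus the old
    distance; the r-th power is split by the linear estimate and integrated. *)
Lemma wasserstein_empirical_move n (y y' : 'I_n -> T)
    (eta : {measure set T -> \bar R}) (r c1 c2 : R) :
  (0 < r)%R -> (0 < n)%N -> (0 < c1)%R -> (0 <= c2)%R ->
  (forall a b : R, 0 <= a -> 0 <= b ->
    (a + b) `^ r <= c1 * a `^ r + c2 * b `^ r)%R ->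
  wasserstein dist r (empirical y) eta `^ r <=
  c1%:E * wasserstein dist r (empirical y') eta `^ r +
  (c2 * (n%:R^-1 * \sum_(i < n) dist (y i) (y' i) `^ r))%:E.
Proof.
move=> r0 n0 c10 c20 c12; rewrite [in leRHS]wasserstein_powR//.
apply: lee_ereal_inf_affine => // _ [pi cpi <-].
have [m [rho crho [mpi splitpi rhoI]]] :=
  coupling_move_empirical mset1 y n0 cpi.
apply: le_trans (wasserstein_powR_le r0 crho) _.
have mD a : measurable [set z : T * T | z.1 = a].
  exact: measurable_fst_eq.
have mdistr : measurable_fun [set: T * T] (fun z => (dist z.1 z.2 `^ r)%:E).
  by apply/measurable_EFinP; exact: (measurableT_comp (@measurable_powR R r)).
have mdist1 a : measurable_fun [set: T * T] (fun z => (dist a z.2 `^ r)%:E).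
  have ma : measurable_fun [set: T * T] (fun z => (a, z.2)).
    exact: measurable_fun_pair.
  exact: (measurableT_comp mdistr ma).
rewrite rhoI//; last by move=> z; rewrite lee_fin powR_ge0.
rewrite -splitpi//; last by move=> z; rewrite lee_fin powR_ge0.
rewrite ge0_sume_distrr; last first.
  move=> i _; rewrite mule_ge0 ?lee_fin ?invr_ge0//.
  by apply: integral_ge0 => z _; rewrite lee_fin powR_ge0.
(* Writing each 1 / n as the mass given to index i turns the constant into integrals over the
   strips, so the two sides can be compared term by term. *)
have -> : (c2 * (n%:R^-1 * \sum_(i < n) dist (y i) (y' i) `^ r))%:E =
    \sum_(i < n) (c2 * dist (y i) (y' i) `^ r)%:E *
      ((m i)%:R^-1%:E * pi [set z | z.1 = y' i]).
  rewrite (eq_bigr (fun i =>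
      (c2 * dist (y i) (y' i) `^ r)%:E * (n%:R^-1)%:E)); last first.
    by move=> i _; congr (_ * _); exact: mpi.
  rewrite !mulr_sumr -sumEFin; apply: eq_bigr => i _.
  by rewrite -EFinM -mulrA [in RHS](mulrC (_ `^ _)%R).
rewrite -big_split/=; apply: lee_sum => i _.
have im0 : (0 <= (m i)%:R^-1 :> R)%R by rewrite invr_ge0.
have I0 : 0 <= \int[pi]_(z in [set z | z.1 = y' i])
    (dist z.1 z.2 `^ r)%:E.
  by apply: integral_ge0 => z _; rewrite lee_fin powR_ge0.
set K := (c2 * _)%:E; have K0 : 0 <= K by rewrite lee_fin mulr_ge0 ?powR_ge0.
have cI0 : 0 <= c1%:E * \int[pi]_(z in [set z | z.1 = y' i])
    (dist z.1 z.2 `^ r)%:E by rewrite mule_ge0// lee_fin ltW.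
have KD0 : 0 <= K * pi [set z | z.1 = y' i] by rewrite mule_ge0.
rewrite !(muleCA _ (m i)%:R^-1%:E) -ge0_muleDr//.
apply: lee_wpmul2l => //.
have mDi := mD (y' i).
have mdistD := measurable_funTS (D := [set z | z.1 = y' i]) mdistr.
have mdist1D := measurable_funTS (D := [set z | z.1 = y' i]) (mdist1 (y i)).
rewrite -integral_cst// -ge0_integralZl_EFin//; last exact: ltW.
have mcdist : measurable_fun [set z : T * T | z.1 = y' i]
    (fun z => c1%:E * (dist z.1 z.2 `^ r)%:E) by exact: measurable_funeM.
have cd0 (z : T * T) : 0 <= c1%:E * (dist z.1 z.2 `^ r)%:E.
  by rewrite mule_ge0 ?lee_fin ?powR_ge0 ?(ltW c10).
rewrite -ge0_integralD//.
apply: ge0_le_integral => //.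
- by move=> z _; rewrite lee_fin powR_ge0.
- exact: emeasurable_funD.
- move=> z /= zy; rewrite -EFinM -EFinD lee_fin.
  apply: le_trans (c12 _ _ (dist_ge0 _ _) (dist_ge0 _ _)).
  rewrite ge0_ler_powR ?nnegrE ?addr_ge0  ?(ltW r0)//.
  by rewrite -zy addrC dist_triangle.
- by move=> z _; rewrite lee_fin powR_ge0.
Qed.

(** The average of the Dirac masses at (y i, o) is a coupling, and its cost is a finite average of
    real numbers. *)
Lemma wasserstein_empirical_dirac_lty n (y : 'I_n -> T) (o : T) (r : R) :
  (0 < r)%R -> (0 < n)%N ->
  wasserstein dist r (empirical y) (\d_o : {measure set T -> \bar R}) `^ r < +oo.
Proof.
move=> r0 n0.
have w0 (i : 'I_n) : (0 <= n%:R^-1 :> R)%R by rewrite invr_ge0.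
have [|Q [QE QI]] := mixture_probability w0
    (nu := fun i => (\d_(y i, o) : {measure set (T * T) -> \bar R})).
  rewrite (eq_bigr (fun=> (n%:R^-1)%:E)); last first.
    by move=> i _; rewrite /= diracT mule1.
  rewrite sumEFin sumr_const card_ord -[X in X%:E]mulr_natr mulVf//.
  by rewrite pnatr_eq0 -lt0n.
have mdistr : measurable_fun [set: T * T] (fun z => (dist z.1 z.2 `^ r)%:E).
  by apply/measurable_EFinP; exact: (measurableT_comp (@measurable_powR R r)).
have cQ : couplings (empirical y) (\d_o : {measure set T -> \bar R}) Q.
  split => [A mA|B mB].
    rewrite QE; last exact: measurableX.
    rewrite -ge0_sume_distrr//; congr (_ * _); apply: eq_bigr => i _.
    rewrite /= !diracE; congr (_%:R%:E); congr nat_of_bool.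
    by apply/idP/idP => [/set_mem[/= ? _]|/set_mem ?]; apply/mem_set.
  rewrite QE; last exact: measurableX.
  rewrite (eq_bigr (fun=> (n%:R^-1)%:E * \d_o B)); last first.
    move=> i _; congr (_ * _); rewrite /= !diracE; congr (_%:R%:E); congr nat_of_bool.
    by apply/idP/idP => [/set_mem[/= _ ?]|/set_mem ?]; apply/mem_set.
  rewrite -ge0_sume_distrl// sumEFin sumr_const card_ord -[X in X%:E]mulr_natr.
  by rewrite mulVf ?mul1e// pnatr_eq0 -lt0n.
apply: le_lt_trans (wasserstein_powR_le r0 cQ) _.
rewrite QI//; last by move=> z; rewrite lee_fin powR_ge0.
apply: lte_sum_pinfty => i _.
by rewrite integral_dirac//= diracT mul1e -EFinM ltry.
Qed.

End wasserstein_complements.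

Section alignment_cost.
Context {R : realType} {d : nat}.
Local Notation Rd := (borelRd R d).
Variable r : R.
Hypothesis r1 : (1 <= r)%R.

Let r0 : (0 < r)%R. Proof. exact: lt_le_trans r1. Qed.

Lemma wasserstein_variation_powR J (mu : 'I_J -> {measure set Rd -> \bar R}) :
  wasserstein_variation r mu `^ r =
  ereal_inf [set (J%:R^-1)%:E * \sum_(j < J)
      wasserstein (@euclid_dist R d) r (mu j) (eta : probability Rd R) `^ r
    | eta in finite_moment r].
Proof.
rewrite /wasserstein_variation poweR_ereal_inf//; last first.
  by move=> _ [eta _ <-]; exact: poweR_ge0.
congr ereal_inf; rewrite image_comp; apply: eq_imagel => eta _ /=.
rewrite poweRVK ?gt_eqF// mule_ge0 ?lee_fin ?invr_ge0//.
by apply: sume_ge0 => j _; exact: poweR_ge0.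
Qed.

(** The r-th power of a normalized l^r distance between arrays: the transport cost of matching
    observations with equal indices. *)
Definition sample_cost n J (x x' : 'I_n -> 'I_J -> Rd) : R :=
  (J%:R^-1 * \sum_(j < J) (n%:R^-1 *
    \sum_(i < n) euclid_dist (x i j) (x' i j) `^ r))%R.

Lemma sample_cost_ge0 n J (x x' : 'I_n -> 'I_J -> Rd) : (0 <= sample_cost x x')%R.
Proof.
rewrite mulr_ge0 ?invr_ge0// sumr_ge0// => j _.
by rewrite mulr_ge0 ?invr_ge0// sumr_ge0// => i _; exact: powR_ge0.
Qed.

Lemma sample_costC n J (x x' : 'I_n -> 'I_J -> Rd) :
  sample_cost x x' = sample_cost x' x.
Proof.
rewrite /sample_cost.
by under [in LHS]eq_bigr do under eq_bigr do rewrite euclid_distC.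
Qed.

Section lipschitz_families.
Variables (n J : nat) (G : 'I_J -> set (Rd -> Rd)) (l : R).
Hypotheses (n0 : (0 < n)%N) (J0 : (0 < J)%N) (l0 : (0 <= l)%R).
Hypothesis lipG : forall j phi, G j phi -> forall x y : Rd,
  (euclid_dist (phi x) (phi y) <= l * euclid_dist x y)%R.
Implicit Types x : 'I_n -> 'I_J -> Rd.

Lemma min_alignment_cost_ge0 x : 0 <= min_alignment_cost r G x.
Proof. by apply/ereal_infP => _ [phi _ <-]; exact: poweR_ge0. Qed.

(** Any [phi] and [eta] tried for x' are also admissible for x, and [phi j] enlarges displacements
    by at most the factor l; the two infima are taken afterwards. *)
Lemma min_alignment_cost_move (c1 c2 : R) x x' : (0 < c1)%R -> (0 <= c2)%R ->
  (forall a b : R, 0 <= a -> 0 <= b ->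
    (a + b) `^ r <= c1 * a `^ r + c2 * b `^ r)%R ->
  min_alignment_cost r G x <=
  c1%:E * min_alignment_cost r G x' + (c2 * (l `^ r * sample_cost x x'))%:E.
Proof.
move=> c10 c20 c12; rewrite [in leRHS]/min_alignment_cost.
apply: lee_ereal_inf_affine => // _ [phi Gphi <-].
have costV : min_alignment_cost r G x <= wasserstein_variation r
    (fun j => empirical (fun i => phi j (x i j))) `^ r.
  by apply: ereal_inf_lbound; exists phi.
apply: (le_trans costV); rewrite !wasserstein_variation_powR.
apply: lee_ereal_inf_affine => // _ [eta eta_fin <-].
pose W (z : 'I_n -> 'I_J -> Rd) j := wasserstein (@euclid_dist R d) r
  (empirical (fun i => phi j (z i j))) eta `^ r.
have VW : ereal_inf [set (J%:R^-1)%:E * \sum_(j < J)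
      wasserstein (@euclid_dist R d) r (empirical (fun i => phi j (x i j)))
        (eta : probability Rd R) `^ r
    | eta in finite_moment r] <= (J%:R^-1)%:E * \sum_(j < J) W x j.
  by apply: ereal_inf_lbound; exists eta.
apply: (le_trans VW); rewrite -/(W x').
have move_j j : W x j <= c1%:E * W x' j + (c2 * (n%:R^-1 *
    \sum_(i < n) euclid_dist (phi j (x i j)) (phi j (x' i j)) `^ r))%:E.
  apply: wasserstein_empirical_move => //.
  - exact: borelRd_measurable_set1.
  - exact: measurable_euclid_dist.
  - exact: euclid_dist_ge0.
  - by move=> *; exact: euclid_dist_triangle.
have W0 j : 0 <= W x' j by exact: poweR_ge0.
have c1W0 j : 0 <= c1%:E * W x' j by rewrite mule_ge0// lee_fin ltW.
have Jge0 : 0 <= (J%:R^-1)%:E :> \bar R by rewrite lee_fin invr_ge0.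
have lip_j j : (n%:R^-1 * \sum_(i < n)
      euclid_dist (phi j (x i j)) (phi j (x' i j)) `^ r <=
    l `^ r * (n%:R^-1 * \sum_(i < n) euclid_dist (x i j) (x' i j) `^ r))%R.
  rewrite [leRHS]mulrCA; apply: ler_wpM2l; first by rewrite invr_ge0.
  rewrite mulr_sumr; apply: ler_sum => i _.
  rewrite -powRM ?euclid_dist_ge0//.
  apply: ge0_ler_powR; rewrite ?nnegrE ?mulr_ge0 ?euclid_dist_ge0 ?(ltW r0)//.
  exact: lipG.
apply: (@le_trans _ _ ((J%:R^-1)%:E * \sum_(j < J) (c1%:E * W x' j +
    (c2 * (l `^ r * (n%:R^-1 *
      \sum_(i < n) euclid_dist (x i j) (x' i j) `^ r)))%:E))).
  apply: lee_wpmul2l => //; apply: lee_sum => j _.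
  by apply: le_trans (move_j j) _; rewrite leeD2l// lee_fin ler_wpM2l.
have cW0 : 0 <= \sum_(j < J) c1%:E * W x' j by exact: sume_ge0.
have cS0 : (0 <= \sum_(j < J) c2 * (l `^ r * (n%:R^-1 *
    \sum_(i < n) euclid_dist (x i j) (x' i j) `^ r)))%R.
  apply: sumr_ge0 => j _; rewrite !mulr_ge0 ?powR_ge0 ?invr_ge0//.
  by rewrite sumr_ge0// => i _; exact: powR_ge0.
rewrite big_split/= sumEFin ge0_muleDr//.
rewrite -ge0_sume_distrr// muleCA leeD2l// -EFinM lee_fin.
by rewrite -mulr_sumr -mulr_sumr mulrCA (mulrCA (J%:R^-1)%R).
Qed.

(** Any choice of maps, with [eta] the Dirac mass at the origin, already has finite cost. *)
Lemma min_alignment_cost_lty x : (forall j, G j !=set0) ->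
  min_alignment_cost r G x < +oo.
Proof.
move=> G0; have [phi Gphi] := choice G0.
have costV : min_alignment_cost r G x <= wasserstein_variation r
    (fun j => empirical (fun i => phi j (x i j))) `^ r.
  by apply: ereal_inf_lbound; exists phi.
apply: (le_lt_trans costV); rewrite wasserstein_variation_powR.
pose o : Rd := (0%R : 'rV[R]_d).
pose W j := wasserstein (@euclid_dist R d) r
  (empirical (fun i => phi j (x i j))) (\d_o : probability Rd R) `^ r.
have VW : ereal_inf [set (J%:R^-1)%:E * \sum_(j < J)
      wasserstein (@euclid_dist R d) r (empirical (fun i => phi j (x i j)))
        (eta : probability Rd R) `^ r
    | eta in finite_moment r] <= (J%:R^-1)%:E * \sum_(j < J) W j.
  apply: ereal_inf_lbound; exists (\d_o : probability Rd R) => //.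
  rewrite /finite_moment/= (eq_integral (fun z : Rd => (euclid_dist z o `^ r)%:E)).
    rewrite integral_dirac ?diracT ?mul1e ?ltry//.
    exact: measurable_euclid_dist_powR.
  by move=> z _; rewrite /euclid_dist subr0.
apply: (le_lt_trans VW); apply: lte_mul_pinfty => //.
apply: lte_sum_pinfty => j _; apply: wasserstein_empirical_dirac_lty => //.
exact: measurable_euclid_dist.
Qed.

End lipschitz_families.

End alignment_cost.

(** * The root of the alignment cost as a measurable real function *)

Section alignment.
Context {R : realType} {d : nat}.
Local Notation Rd := (borelRd R d).
Variables (r : R) (n J : nat) (G : 'I_J -> set (Rd -> Rd)) (l : R).
Hypotheses (r1 : (1 <= r)%R) (n0 : (0 < n)%N) (J0 : (0 < J)%N) (l0 : (0 <= l)%R).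
Hypothesis lipG : forall j phi, G j phi -> forall x y : Rd,
  (euclid_dist (phi x) (phi y) <= l * euclid_dist x y)%R.
Hypothesis G0 : forall j, G j !=set0.
Implicit Types x : 'I_n -> 'I_J -> Rd.

Let r0 : (0 < r)%R. Proof. exact: lt_le_trans r1. Qed.
Let rN0 : r != 0%R. Proof. by rewrite gt_eqF. Qed.

(** Real-valued so that it can serve as a random variable; [alignmentE] shows that [fine] loses
    nothing. *)
Definition alignment x : R := fine (min_alignment_cost r G x `^ r^-1).

Lemma alignment_ge0 x : (0 <= alignment x)%R.
Proof. by rewrite fine_ge0// poweR_ge0. Qed.

Lemma alignmentE x : (alignment x)%:E = min_alignment_cost r G x `^ r^-1.
Proof.
rewrite fineK// fin_num_poweR// ge0_fin_numE ?min_alignment_cost_ge0//.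
exact: min_alignment_cost_lty.
Qed.

Lemma alignment_powR x : (alignment x `^ r)%:E = min_alignment_cost r G x.
Proof. by rewrite -poweR_EFin alignmentE poweRVK// min_alignment_cost_ge0. Qed.

Definition sample_dist x x' : R := (sample_cost r x x' `^ r^-1)%R.

Lemma sample_dist_ge0 x x' : (0 <= sample_dist x x')%R.
Proof. exact: powR_ge0. Qed.

Lemma sample_distC x x' : sample_dist x x' = sample_dist x' x.
Proof. by rewrite /sample_dist sample_costC. Qed.

Lemma sample_dist_powR x x' : (sample_dist x x' `^ r = sample_cost r x x')%R.
Proof. by rewrite -powRrM mulVf// powRr1// sample_cost_ge0. Qed.

Lemma alignment_le x x' : (alignment x <= alignment x' + l * sample_dist x x')%R.
Proof.
apply: (@minkowski_principle _ r) => //; rewrite ?alignment_ge0//.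
  by rewrite mulr_ge0// sample_dist_ge0.
move=> c1 c2 c10 c20 c12.
rewrite -lee_fin alignment_powR powRM ?sample_dist_ge0// sample_dist_powR.
rewrite EFinD EFinM alignment_powR.
exact: min_alignment_cost_move.
Qed.

Lemma alignment_lipschitz x x' :
  (`|alignment x - alignment x'| `^ r <= l `^ r * sample_cost r x x')%R.
Proof.
rewrite -sample_dist_powR -powRM ?sample_dist_ge0//.
apply: ge0_ler_powR; rewrite ?nnegrE ?mulr_ge0 ?sample_dist_ge0 ?(ltW r0)//.
rewrite ler_norml lerBlDl alignment_le andbT lerNl opprB lerBlDl.
by rewrite sample_distC alignment_le.
Qed.

Lemma sample_dist_le (e : R) x x' : (0 <= e)%R ->
  (forall i j, euclid_dist (x i j) (x' i j) <= e)%R -> (sample_dist x x' <= e)%R.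
Proof.
move=> e0 xe; rewrite -[leRHS](_ : (e `^ r) `^ r^-1 = e)%R; last first.
  by rewrite -powRrM divff// powRr1.
apply: ge0_ler_powR; rewrite ?nnegrE ?invr_ge0 ?powR_ge0 ?sample_cost_ge0 ?(ltW r0)//.
have avg k (F : 'I_k -> R) : (0 < k)%N -> (forall i, F i <= e `^ r)%R ->
    (k%:R^-1 * \sum_(i < k) F i <= e `^ r)%R.
  move=> k0 Fe; rewrite ler_pdivrMl ?ltr0n//.
  apply: (@le_trans _ _ (\sum_(i < k) e `^ r)%R); first exact: ler_sum.
  by rewrite sumr_const card_ord mulr_natl.
apply: (avg) => // j; apply: (avg) => // i.
by apply: ge0_ler_powR; rewrite ?nnegrE ?euclid_dist_ge0 ?(ltW r0)// xe.
Qed.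

Let grid (q : {ffun 'I_n * 'I_J * 'I_d -> rat}) : 'I_n -> 'I_J -> Rd :=
  fun i j => (\row_k ratr (q (i, j, k)) : 'rV[R]_d).

Lemma rational_sample_dense x (e : R) : (0 < e)%R ->
  exists q, (l * sample_dist x (grid q) < e)%R.
Proof.
(* Coordinate errors [D] give distances at most d D, and l d D < e; the added 1 keeps the
   denominator positive when l = 0. *)
move=> e0; pose D : R := (e / (l * d%:R + 1))%R.
have ld0 : (0 < l * d%:R + 1)%R by rewrite ltr_wpDl ?mulr_ge0.
have D0 : (0 < D)%R by rewrite divr_gt0.
have /choice[q qP] (t : 'I_n * 'I_J * 'I_d) : exists q : rat,
    (`|(x t.1.1 t.1.2 : 'rV[R]_d) ord0 t.2 - ratr q| <= D)%R.
  pose a := (x t.1.1 t.1.2 : 'rV[R]_d) ord0 t.2; rewrite -/a.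
  have [|q] := @rat_in_itvoo R (a - D)%R (a + D)%R.
    by rewrite ltrD2l gt0_cp.
  rewrite in_itv/= => /andP[q1 q2]; exists q.
  by rewrite ler_distlC !ltW.
exists [ffun t => q t].
have dD i j : (euclid_dist (x i j) (grid [ffun t => q t] i j) <= d%:R * D)%R.
  apply: euclid_norm_le; first exact: ltW.
  by move=> k; rewrite !mxE ffunE; exact: qP (i, j, k).
have dD0 : (0 <= d%:R * D)%R by rewrite mulr_ge0// ltW.
apply: (@le_lt_trans _ _ (l * (d%:R * D))%R).
  by apply: ler_wpM2l => //; exact: sample_dist_le.
rewrite mulrA /D mulrA ltr_pdivrMr// mulrC.
by rewrite ltr_pM2l// ltrDl.
Qed.

Lemma measurable_sample_dist dO (O : measurableType dO)
    (X : 'I_n -> 'I_J -> O -> Rd) x :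
  (forall i j, measurable_fun setT (X i j)) ->
  measurable_fun setT (fun w => sample_dist (fun i j => X i j w) x).
Proof.
move=> mX; apply: (measurableT_comp (@measurable_powR R r^-1)).
apply: measurable_funM => //; apply: measurable_sum => j.
apply: measurable_funM => //; apply: measurable_sum => i.
apply: (measurableT_comp (@measurable_powR R r)).
exact: measurable_euclid_dist.
Qed.

(** Here v is the value at the sample, u the value at a grid point and s the Lipschitz error, which
    is paid twice. *)
Let half_gap (a u v s : R) : (s < (a - v) / 2 -> u <= v + s -> u + s < a)%R.
Proof. lra. Qed.

(** The value at x is below a exactly when some rational sample q has value plus l times its
    distance to x below a; this is a countable union of measurable conditions. *)
Lemma measurable_alignment dO (O : measurableType dO)
    (X : 'I_n -> 'I_J -> O -> Rd) :
  (forall i j, measurable_fun setT (X i j)) ->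
  measurable_fun setT (fun w => alignment (fun i j => X i j w)).
Proof.
move=> mX; apply: (measurability (@RGenInftyO.G R)).
  exact: RGenInftyO.measurableE.
move=> _ [_ [a ->] <-]; rewrite setTI.
pose F q := [set w : O | (alignment (grid q) +
  l * sample_dist (fun i j => X i j w) (grid q) < a)%R].
rewrite (_ : _ @^-1` _ = \bigcup_q F q); last first.
  apply/seteqP; split => w /=; rewrite in_itv/=.
    move=> fa; have [|q qe] := @rational_sample_dense (fun i j => X i j w)
      ((a - alignment (fun i j => X i j w)) / 2)%R.
      by rewrite divr_gt0// subr_gt0.
    exists q => //; rewrite /F/=.
    have := alignment_le (grid q) (fun i j => X i j w).
    by rewrite sample_distC; exact: half_gap qe.
  by move=> [q _]; apply: le_lt_trans; exact: alignment_le.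
apply: countable_bigcupT_measurable => [|q]; first exact: countableP.
rewrite -[F q]setTI; apply: measurable_fun_ltr => //.
apply: measurable_funD => //; apply: measurable_funM => //.
exact: measurable_sample_dist.
Qed.

End alignment.

(** * Laws of samples on tuple spaces *)

Lemma pushforward_probability (R : realType) d d' (T : measurableType d)
    (T' : measurableType d') (P : probability T R)
    (f : T -> T') : measurable_fun setT f ->
  exists Q : probability T' R, (forall A, Q A = P (f @^-1` A)) /\
    forall g : T' -> \bar R, measurable_fun setT g -> (forall x, 0 <= g x) ->
      \int[Q]_x g x = \int[P]_x g (f x).
Proof.
move=> mf.
pose h : {mfun T >-> T'} := HB.pack f (isMeasurableFun.Build _ _ _ _ f mf).
by exists (distribution P h); split => // g mg g0; rewrite ge0_integral_distribution.
Qed.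

Section tuple_probability.
Context {R : realType} {d : measure_display} {T : measurableType d}.

Definition box n (B : 'I_n -> set T) : set (n.-tuple T) :=
  [set t | forall i, B i (tnth t i)].

Lemma boxE n (B : 'I_n -> set T) :
  box B = \bigcap_i ((@tnth n T)^~ i @^-1` B i).
Proof. by apply/seteqP; split => [t tB i _|t tB i]; exact: tB. Qed.

Lemma measurable_box n (B : 'I_n -> set T) :
  (forall i, measurable (B i)) -> measurable (box B).
Proof.
move=> mB; rewrite boxE; apply: fin_bigcap_measurable => [|i _].
  exact: finite_finset.
by rewrite -[X in measurable X]setTI; exact: measurable_tnth.
Qed.

(** Boxes are stable under intersection and generate the sigma-algebra of tuples. *)
Lemma tuple_measure_unique n (P Q : probability (n.-tuple T) R) :
  (forall B : 'I_n -> set T, (forall i, measurable (B i)) ->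
    P (box B) = Q (box B)) ->
  forall A, measurable A -> P A = Q A.
Proof.
move=> PQ A mA.
pose C := [set D | exists2 B : 'I_n -> set T,
  (forall i, measurable (B i)) & D = box B].
apply: (measure_unique C (fun=> setT)) => //.
- apply/seteqP; split.
    apply: smallest_sub; first exact: smallest_sigma_algebra.
    move=> D; rewrite -bigcup_seq/= => -[i _ [B mB <-]].
    (* A generator constrains a single coordinate, hence is a box with all other sides full. *)
    apply: sub_sigma_algebra; exists (fun j => if j == i then B else setT).
      by move=> j; case: ifP.
    rewrite setTI; apply/seteqP; split => [t/= tB j|t /(_ i)]/=; last by rewrite eqxx.
    by case: eqP => // ->.
  apply: smallest_sub; first exact: sigma_algebra_measurable.
  by move=> _ [B mB ->]; exact: measurable_box.
- move=> _ _ [B mB ->] [B' mB' ->]; exists (fun i => B i `&` B' i).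
    by move=> i; exact: measurableI.
  by apply/seteqP; split => [t [tB tB'] i|t tB]; [split|split => i; have [] := tB i].
- by move=> _; exists (fun=> setT) => //; apply/seteqP; split.
- by rewrite bigcup_const//; exists 0%N.
- by move=> _ [B mB ->]; exact: PQ.
- by move=> _; rewrite /= probability_setT ltry.
Qed.

(** Built one coordinate at a time, as the image of a binary product measure under cons. *)
Lemma tuple_product_probability n (p : 'I_n -> probability T R) :
  exists Q : probability (n.-tuple T) R,
    forall B : 'I_n -> set T, (forall i, measurable (B i)) ->
      Q (box B) = \prod_(i < n) p i (B i).
Proof.
elim: n p => [|n IH] p.
  exists (\d_([tuple] : 0.-tuple T)) => B mB.
  by rewrite big_ord0 /= diracE mem_set// => -[].
have [Q QE] := IH (fun i => p (lift ord0 i)).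
have mcons : measurable_fun [set: T * n.-tuple T]
    (fun z => [the n.+1.-tuple T of z.1 :: z.2]).
  exact: measurable_cons.
have [Q' [Q'E _]] := pushforward_probability (p ord0 \x Q)%E mcons.
exists Q' => B mB; rewrite Q'E big_ord_recl -QE//.
have mB' : measurable (box (fun i => B (lift ord0 i))).
  by apply: measurable_box => i.
rewrite -product_measure1E//; congr (product_measure1 _ _ _).
apply/seteqP; split => [[a t] /= tB|[a t] [/= Ba tB] i].
  split => [|i]; first by have := tB ord0; rewrite tnth0.
  by have := tB (lift ord0 i); rewrite tnthS.
by case: (unliftP ord0 i) => [j ->|->]; rewrite ?tnthS ?tnth0.
Qed.

End tuple_probability.

(** The choices for different j are independent, so near-minimizers can be selected
    simultaneously. *)
Lemma lee_sum_ereal_inf (R : realType) J (S : 'I_J -> set (\bar R)) (c : R)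
    (a : \bar R) :
  (0 <= c)%R -> (forall j s, S j s -> 0 <= s) -> (forall j, S j !=set0) ->
  (forall s : 'I_J -> \bar R, (forall j, S j (s j)) ->
    a <= c%:E * \sum_(j < J) s j) ->
  a <= c%:E * \sum_(j < J) ereal_inf (S j).
Proof.
move=> c0 S0 SN0 aS.
have inf0 j : 0 <= ereal_inf (S j) by apply/ereal_infP => s /S0.
have := c0; rewrite le_eqVlt => /predU1P[c_eq0|c_gt0].
  have [s Ss] := choice SN0.
  by have := aS s Ss; rewrite -c_eq0 !mul0e.
have [inf_fin|] := pselect (forall j, ereal_inf (S j) < +oo); last first.
  move=> /existsNP[j /negP]; rewrite -leNgt leye_eq => /eqP infj.
  rewrite (bigD1 j)//= infj addye ?gt0_muley ?leey//.
  by rewrite gt_eqF// (lt_le_trans ltNy0)// sume_ge0.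
apply/lee_addgt0Pr => e e0.
(* The J errors, multiplied by c, add up to at most e; [J.+1] keeps the denominator positive when J
   = 0. *)
pose D : R := (e / (c * J.+1%:R))%R.
have cJ0 : (0 < c * J.+1%:R)%R by rewrite mulr_gt0.
have D0 : (0 < D)%R by rewrite divr_gt0.
have /choice[s sP] j : exists s, S j s /\ s <= ereal_inf (S j) + D%:E.
  have [|s Ss sD] := @lb_ereal_inf_adherent _ (S j) D D0.
    by rewrite ge0_fin_numE.
  by exists s; split => //; exact: ltW.
apply: (le_trans (aS s (fun j => (sP j).1))).
apply: (@le_trans _ _ (c%:E * \sum_(j < J) (ereal_inf (S j) + D%:E))).
  by apply: lee_wpmul2l => //; apply: lee_sum => j _; exact: (sP j).2.
rewrite big_split/= ge0_muleDr ?sume_ge0// => [|j _]; last by rewrite lee_fin ltW.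
rewrite leeD2l// sumEFin sumr_const card_ord -EFinM lee_fin.
rewrite -[X in (_ * X)%R]mulr_natr mulrCA /D -[leLHS]mulrA ler_piMr ?(ltW e0)//.
by rewrite ler_pdivrMl// mulr1 ler_pM2l// ler_nat.
Qed.

Section sample_law.
Context {R : realType} {dS dT : measure_display}.
Context {S : measurableType dS} {T : measurableType dT} {n J : nat}.
Local Notation N := #|{: 'I_n * 'I_J}|.
Variables (p : 'I_J -> probability S R) (Q : probability (N.-tuple S) R).
Hypothesis QE : forall B : 'I_N -> set S, (forall k, measurable (B k)) ->
  Q (box B) = \prod_(k < N) p (enum_val k).2 (B k).

(** Both sides are laws on tuples, with the pairs (i, j) laid out by [enum_val]. On boxes both are
    products of values of the [mu j], by the choice of [Q] on one side and independence on the
    other. *)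
Lemma tuple_sample_law dO (O : measurableType dO) (P : probability O R)
    (mu : 'I_J -> probability T R) (X : 'I_n -> 'I_J -> {RV P >-> T})
    (phi : S -> T) :
  measurable_fun setT phi ->
  (forall j B, measurable B -> p j (phi @^-1` B) = mu j B) ->
  iid_samples mu X ->
  forall A : set (N.-tuple T), measurable A ->
  Q [set t | A (map_tuple phi t)] =
  P [set w | A (mktuple (fun k => X (enum_val k).1 (enum_val k).2 w))].
Proof.
move=> mphi pphi [indX lawX] A mA.
pose F (t : N.-tuple S) := map_tuple phi t.
pose H (w : O) : N.-tuple T := mktuple (fun k => X (enum_val k).1 (enum_val k).2 w).
have mF : measurable_fun setT F.
  apply/measurable_fun_tnthP => k.
  rewrite (_ : _ \o _ = phi \o (fun t => tnth t k)).
    by apply: measurableT_comp => //; exact: measurable_tnth.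
  by apply/funext => t; rewrite /= tnth_map.
have mH : measurable_fun setT H.
  apply/measurable_fun_tnthP => k.
  rewrite (_ : _ \o _ = X (enum_val k).1 (enum_val k).2)//.
  by apply/funext => w; rewrite /= tnth_mktuple.
have [QF [QFE _]] := pushforward_probability Q mF.
have [PH [PHE _]] := pushforward_probability P mH.
rewrite -/(F @^-1` A) -/(H @^-1` A) -QFE -PHE.
apply: tuple_measure_unique => // B mB; rewrite QFE PHE.
transitivity (\prod_(k < N) mu (enum_val k).2 (B k)).
  have -> : F @^-1` box B = box (fun k => phi @^-1` B k).
    by apply/seteqP; split => t tB k; have := tB k; rewrite /= /F tnth_map.
  rewrite QE; last by move=> k; rewrite -[X in measurable X]setTI; exact: mphi.
  by apply: eq_bigr => k _; rewrite pphi.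
have -> : H @^-1` box B = \bigcap_(ij in [set` [set: 'I_n * 'I_J]%SET])
    (X ij.1 ij.2 @^-1` B (enum_rank ij)).
  apply/seteqP; split => w wB; last first.
    move=> k; rewrite /H tnth_mktuple -[k in B k]enum_valK; apply: wB.
    by rewrite /= inE.
  by move=> ij _; have := wB (enum_rank ij); rewrite /H tnth_mktuple enum_rankK.
rewrite (indX [set: 'I_n * 'I_J]%SET (fun ij => B (enum_rank ij)))//.
rewrite [RHS](reindex (@enum_val _ {: 'I_n * 'I_J})); last first.
  by exists enum_rank => ij _; rewrite ?enum_valK ?enum_rankK.
apply: eq_big => [k|k _]; first by rewrite inE.
by rewrite enum_valK; apply/esym; exact: lawX.
Qed.

(** A one-coordinate cylinder is a box, so the k-th marginal of [Q] is the corresponding factor. *)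
Lemma integral_tuple_coord (k : 'I_N) (f : S -> \bar R) :
  measurable_fun setT f -> (forall z, 0 <= f z) ->
  \int[Q]_t f (tnth t k) = \int[p (enum_val k).2]_z f z.
Proof.
move=> mf f0.
have [Qk [QkE QkI]] := pushforward_probability Q (measurable_tnth k).
rewrite -QkI//; apply: eq_measure_integral => A mA _.
transitivity (Q ((@tnth _ S)^~ k @^-1` A)); first exact: QkE.
have -> : (@tnth _ S)^~ k @^-1` A = box (fun j => if j == k then A else setT).
  apply/seteqP; split => [t/= tA j|t /(_ k)]/=; last by rewrite eqxx.
  by case: eqP => // ->.
rewrite QE => [|j]; last by case: ifP.
rewrite (bigD1 k)//= eqxx big1 ?mule1// => j /negbTE ->.
exact: probability_setT.
Qed.

Lemma integral_tuple_sum (f : S -> \bar R) :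
  measurable_fun setT f -> (forall z, 0 <= f z) ->
  \int[Q]_t (\sum_(j < J) \sum_(i < n) f (tnth t (enum_rank (i, j)))) =
  n%:R%:E * \sum_(j < J) \int[p j]_z f z.
Proof.
move=> mf f0.
have mft k : measurable_fun setT (fun t : N.-tuple S => f (tnth t k)).
  by apply: measurableT_comp => //; exact: measurable_tnth.
rewrite ge0_integral_sum//; last 2 first.
- by move=> j; exact: emeasurable_sum.
- by move=> j t _; exact: sume_ge0.
rewrite ge0_sume_distrr; last by move=> j _; exact: integral_ge0.
apply: eq_bigr => j _; rewrite ge0_integral_sum//.
rewrite (eq_bigr (fun=> \int[p j]_z f z)) => [|i _].
  by rewrite sumr_const card_ord mule_natl.
by rewrite integral_tuple_coord// enum_rankK.
Qed.

End sample_law.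

(** * Coupling the alignment costs of two samples *)

Section alignment_law.
Context {R : realType} {d : nat}.
Local Notation Rd := (borelRd R d).
Variables (r : R) (n J : nat) (G : 'I_J -> set (Rd -> Rd)) (l : R).
Hypotheses (r1 : (1 <= r)%R) (n0 : (0 < n)%N) (J0 : (0 < J)%N) (l0 : (0 <= l)%R).
Hypothesis lipG : forall j phi, G j phi -> forall x y : Rd,
  (euclid_dist (phi x) (phi y) <= l * euclid_dist x y)%R.
Hypothesis G0 : forall j, G j !=set0.
Local Notation N := #|{: 'I_n * 'I_J}|.

Let al (t : N.-tuple Rd) : R :=
  alignment r G (fun i j => tnth t (enum_rank (i, j))).

Let measurable_al : measurable_fun setT al.
Proof.
by apply: (measurable_alignment r1 n0 J0 l0 lipG G0) => i j; exact: measurable_tnth.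
Qed.

(** Taking [phi] to be each projection of a pair, one law [Q] reproduces both alignment laws. *)
Lemma alignment_law_tuple (dS : measure_display) (S : measurableType dS)
    (p : 'I_J -> probability S R) (Q : probability (N.-tuple S) R)
    dO (O : measurableType dO) (P : probability O R)
    (mu : 'I_J -> probability Rd R) (X : 'I_n -> 'I_J -> {RV P >-> Rd})
    (phi : S -> Rd) (A : set R) :
  (forall B : 'I_N -> set S, (forall k, measurable (B k)) ->
    Q (box B) = \prod_(k < N) p (enum_val k).2 (B k)) ->
  measurable_fun setT phi ->
  (forall j B, measurable B -> p j (phi @^-1` B) = mu j B) ->
  iid_samples mu X -> measurable A ->
  Q [set t | A (alignment r G (fun i j => phi (tnth t (enum_rank (i, j)))))] =
  P [set w | A (alignment r G (fun i j => X i j w))].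
Proof.
move=> QE mphi pphi hX mA.
have mB : measurable (al @^-1` A).
  by rewrite -[X in measurable X]setTI; exact: measurable_al.
have al_map (t : N.-tuple S) : al (map_tuple phi t) =
    alignment r G (fun i j => phi (tnth t (enum_rank (i, j)))).
  rewrite /al; apply: (f_equal (alignment r G)).
  by apply/funext => i; apply/funext => j; rewrite tnth_map.
have al_mk w : al (mktuple (fun k => X (enum_val k).1 (enum_val k).2 w)) =
    alignment r G (fun i j => X i j w).
  rewrite /al; apply: (f_equal (alignment r G)).
  by apply/funext => i; apply/funext => j; rewrite tnth_mktuple enum_rankK.
under eq_set do rewrite -al_map.
under [in RHS]eq_set do rewrite -al_mk.
exact: (tuple_sample_law QE mphi pphi hX mB).
Qed.

(** The couplings [p j] are arbitrary here; minimizing over them is left to the theorem. *)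
Lemma wasserstein_alignment_le
    dO (O : measurableType dO) (P : probability O R)
    dO' (O' : measurableType dO') (P' : probability O' R)
    (mu mu' : 'I_J -> probability Rd R)
    (X : 'I_n -> 'I_J -> {RV P >-> Rd}) (X' : 'I_n -> 'I_J -> {RV P' >-> Rd})
    (Y : {RV P >-> R}) (Y' : {RV P' >-> R})
    (p : 'I_J -> probability (Rd * Rd)%type R) :
  iid_samples mu X -> iid_samples mu' X' ->
  (forall w, Y w = alignment r G (fun i j => X i j w)) ->
  (forall w, Y' w = alignment r G (fun i j => X' i j w)) ->
  (forall j, couplings (mu j) (mu' j) (p j)) ->
  wasserstein (@real_dist R) r (distribution P Y) (distribution P' Y') `^ r <=
  (l `^ r / J%:R)%:E *
    \sum_(j < J) \int[p j]_z (euclid_dist z.1 z.2 `^ r)%:E.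
Proof.
move=> hX hX' YE Y'E cp.
have r0 : (0 < r)%R by exact: lt_le_trans r1.
have [Q QE] := tuple_product_probability (fun k : 'I_N => p (enum_val k).2).
pose a1 (t : N.-tuple (Rd * Rd)) :=
  alignment r G (fun i j => (tnth t (enum_rank (i, j))).1).
pose a2 (t : N.-tuple (Rd * Rd)) :=
  alignment r G (fun i j => (tnth t (enum_rank (i, j))).2).
have mt1 k : measurable_fun setT (fun t : N.-tuple (Rd * Rd) => (tnth t k).1).
  by apply: (measurableT_comp measurable_fst); exact: measurable_tnth.
have mt2 k : measurable_fun setT (fun t : N.-tuple (Rd * Rd) => (tnth t k).2).
  by apply: (measurableT_comp measurable_snd); exact: measurable_tnth.
have ma1 : measurable_fun setT a1.
  exact: (measurable_alignment r1 n0 J0 l0 lipG G0).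
have ma2 : measurable_fun setT a2.
  exact: (measurable_alignment r1 n0 J0 l0 lipG G0).
have ma : measurable_fun setT (fun t => (a1 t, a2 t)).
  exact: (measurable_fun_pair ma1 ma2).
have [rho [rhoE rhoI]] := pushforward_probability Q ma.
have crho : couplings (distribution P Y) (distribution P' Y') rho.
  split=> [A mA|B mB]; rewrite rhoE.
    transitivity (Q [set t | A (a1 t)]).
      by congr (Q _); apply/seteqP; split => [t []|t At]//; split.
    rewrite (alignment_law_tuple QE measurable_fst _ hX mA).
      by congr (P _); apply/funext => w; rewrite /= YE.
    move=> j B mB; rewrite -(cp j).1//; congr (p j _).
    by apply/seteqP; split => [z Bz|z []]//; split.
  transitivity (Q [set t | B (a2 t)]).
    by congr (Q _); apply/seteqP; split => [t []|t Bt]//; split.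
  rewrite (alignment_law_tuple QE measurable_snd _ hX' mB).
    by congr (P' _); apply/funext => w; rewrite /= Y'E.
  move=> j A mA; rewrite -(cp j).2//; congr (p j _).
  by apply/seteqP; split => [z Az|z []]//; split.
have mreal : measurable_fun [set: R * R] (fun z => (real_dist z.1 z.2 `^ r)%:E).
  apply/measurable_EFinP; apply: (measurableT_comp (@measurable_powR R r)).
  by apply: measurableT_comp => //; exact: measurable_funB.
apply: (le_trans (wasserstein_powR_le _ r0 crho)).
rewrite rhoI//; last by move=> z; rewrite lee_fin powR_ge0.
pose f (z : Rd * Rd) : \bar R := (euclid_dist z.1 z.2 `^ r)%:E.
have mf : measurable_fun setT f.
  exact: (measurable_euclid_dist_powR r measurable_fst measurable_snd).
have f0 z : 0 <= f z by rewrite lee_fin powR_ge0.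
pose S (t : N.-tuple (Rd * Rd)) : \bar R :=
  \sum_(j < J) \sum_(i < n) f (tnth t (enum_rank (i, j))).
have S0 t : 0 <= S t by apply: sume_ge0 => j _; exact: sume_ge0.
have mS : measurable_fun setT S.
  apply: emeasurable_sum => j; apply: emeasurable_sum => i.
  exact: (measurableT_comp mf (measurable_tnth _)).
(* The factors 1 / J and 1 / n are the averages in [sample_cost]; integrating [S] yields a factor n,
   which cancels 1 / n. *)
pose c : R := (l `^ r / J%:R / n%:R)%R.
have c0 : (0 <= c)%R by rewrite !divr_ge0// powR_ge0.
have le_S t : (real_dist (a1 t) (a2 t) `^ r)%:E <= c%:E * S t.
  have -> : c%:E * S t = (l `^ r * sample_cost r
      (fun i j => (tnth t (enum_rank (i, j))).1)
      (fun i j => (tnth t (enum_rank (i, j))).2))%:E.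
    rewrite /S /sample_cost -mulr_sumr.
    under eq_bigr do rewrite sumEFin.
    by rewrite sumEFin -EFinM /c -!mulrA.
  rewrite lee_fin; exact: alignment_lipschitz.
apply: (@le_trans _ _ (\int[Q]_t (c%:E * S t))).
  apply: ge0_le_integral => //.
  - by move=> t _; rewrite lee_fin powR_ge0.
  - exact: (measurableT_comp mreal ma).
  - exact: measurable_funeM.
  - by move=> t _; exact: le_S.
rewrite ge0_integralZl_EFin//.
by rewrite (integral_tuple_sum QE mf f0) muleA -EFinM /c divfK ?pnatr_eq0 -?lt0n//.
Qed.

End alignment_law.

(** * Lipschitz suprema and the final bound *)

Lemma lipschitz_sup_le (R : realType) d (F : set (borelRd R d -> borelRd R d))
    (l : R) phi x y :
  lipschitz_sup F <= l%:E -> F phi ->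
  (euclid_dist (phi x) (phi y) <= l * euclid_dist x y)%R.
Proof.
move=> Fl Fphi; have [->|/eqP xy] := eqVneq x y.
  by rewrite !euclid_dist_xx mulr0.
have d0 : (0 < euclid_dist x y)%R.
  rewrite lt_neqAle euclid_dist_ge0 andbT; apply/eqP => /esym.
  by move=> /euclid_dist_eq0.
rewrite -ler_pdivrMr// -lee_fin; apply: le_trans Fl.
by apply: ereal_sup_ubound; exists phi, x, y.
Qed.

(** Positive dimension supplies two distinct points; without them the supremum would be over the
    empty set, hence -oo. *)
Lemma lipschitz_sup_ge0 (R : realType) d (F : set (borelRd R d -> borelRd R d)) :
  (0 < d)%N -> F !=set0 -> 0 <= lipschitz_sup F.
Proof.
move=> d0 [phi Fphi].
pose x : borelRd R d := (0%R : 'rV[R]_d).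
pose y : borelRd R d := (const_mx 1%R : 'rV[R]_d).
apply: (@le_trans _ _ (euclid_dist (phi x) (phi y) / euclid_dist x y)%:E).
  by rewrite lee_fin divr_ge0// euclid_dist_ge0.
apply: ereal_sup_ubound; exists phi, x, y; split => // xy.
have : ((x : 'rV[R]_d) ord0 (Ordinal d0) = (y : 'rV[R]_d) ord0 (Ordinal d0))%R.
  by rewrite xy.
by rewrite !mxE => /eqP; rewrite eq_sym oner_eq0.
Qed.

Theorem theorem3 (R : realType) (d J n : nat) (r : R)
  (hd : (1 <= d)%N) (hJ : (1 <= J)%N) (hn : (1 <= n)%N) (hr : (1 <= r)%R)
  (G : 'I_J -> set (borelRd R d -> borelRd R d))
  (hG0 : forall j, G j !=set0)
  (hGinv : forall j phi, G j phi -> bijective phi)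
  (L : \bar R)
  (hL : L = \big[maxe/-oo]_(j < J) lipschitz_sup (G j))
  (hLfin : L < +oo)
  (mu mu' : 'I_J -> probability (borelRd R d) R)
  (hmu : forall j, finite_moment r (mu j))
  (hmu' : forall j, finite_moment r (mu' j))
  (dO : measure_display) (O : measurableType dO) (P : probability O R)
  (X : 'I_n -> 'I_J -> {RV P >-> borelRd R d})
  (hX : iid_samples mu X)
  (dO' : measure_display) (O' : measurableType dO') (P' : probability O' R)
  (X' : 'I_n -> 'I_J -> {RV P' >-> borelRd R d})
  (hX' : iid_samples mu' X') :
  exists (Y : {RV P >-> R}) (Y' : {RV P' >-> R}),
    [/\ forall w, (Y w)%:E = min_alignment_cost r G (fun i j => X i j w) `^ r^-1,
        forall w, (Y' w)%:E = min_alignment_cost r G (fun i j => X' i j w) `^ r^-1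
      & wasserstein (@real_dist R) r (distribution P Y) (distribution P' Y') `^ r
        <= L `^ r * ((J%:R^-1)%:E *
             \sum_(j < J) wasserstein (@euclid_dist R d) r (mu j) (mu' j) `^ r)].
Proof.
have r0 : (0 < r)%R by exact: lt_le_trans hr.
have supL j : lipschitz_sup (G j) <= L by rewrite hL; exact: le_bigmax.
have L0 : 0 <= L.
  by apply: le_trans (supL (Ordinal hJ)); exact: lipschitz_sup_ge0.
have LE : L = (fine L)%:E by rewrite fineK// ge0_fin_numE.
move: (fine L) LE => l {hL hLfin} LE; rewrite {}LE in supL L0 *.
move: L0; rewrite lee_fin => l0.
have lipG j phi : G j phi -> forall x y : borelRd R d,
    (euclid_dist (phi x) (phi y) <= l * euclid_dist x y)%R.
  by move=> Gphi x y; exact: lipschitz_sup_le (supL j) Gphi.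
have mY : measurable_fun setT (fun w => alignment r G (fun i j => X i j w)).
  exact: (measurable_alignment hr hn hJ l0 lipG hG0).
have mY' : measurable_fun setT (fun w => alignment r G (fun i j => X' i j w)).
  exact: (measurable_alignment hr hn hJ l0 lipG hG0).
pose Y : {RV P >-> R} := HB.pack (fun w => alignment r G (fun i j => X i j w))
  (isMeasurableFun.Build _ _ _ _ _ mY).
pose Y' : {RV P' >-> R} := HB.pack (fun w => alignment r G (fun i j => X' i j w))
  (isMeasurableFun.Build _ _ _ _ _ mY').
exists Y, Y'; split.
- by move=> w; exact: alignmentE.
- by move=> w; exact: alignmentE.
rewrite poweR_EFin muleA -EFinM.
under eq_bigr do rewrite wasserstein_powR//.
apply: lee_sum_ereal_inf.
- by rewrite divr_ge0// powR_ge0.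
- move=> j _ [p _ <-]; apply: integral_ge0 => z _.
  by rewrite lee_fin powR_ge0.
(* The independent coupling shows that each infimum is over a nonempty set. *)
- move=> j; pose p : probability (borelRd R d * borelRd R d)%type R := (mu j \x mu' j).
  exists (\int[p]_z (euclid_dist z.1 z.2 `^ r)%:E); exists p => //.
  split => [A mA|B mB].
    transitivity (mu j A * mu' j setT); first exact: product_measure1E.
    by rewrite [X in _ * X]probability_setT mule1.
  transitivity (mu j setT * mu' j B); first exact: product_measure1E.
  by rewrite [X in X * _]probability_setT mul1e.
move=> s /(_ _)/cid2-/all_sig2[p cp pE].
under eq_bigr do rewrite -pE.
exact: (wasserstein_alignment_le hr hn hJ l0 lipG hG0 hX hX').
Qed.
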